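(* Let $X=(-\frac12,\frac12)^{\mathbb N}$ with the product $\sigma$-algebra and the product probability measure $\mu$ generated by Lebesgue measure on $(-\frac12,\frac12)$. Then (1) $\mu(S_0\cap X)=1$, and (2) $\mu(\widehat{c}\cap X)=0$.
   Context: A Banach limit is a linear functional $L\colon\ell^\infty\to\mathbb R$ on the space $\ell^\infty$ of bounded real sequences such that for every $(x_n)\in\ell^\infty$: (1) if $x_n\ge0$ for all $n$ then $L((x_n))\ge0$; (2) $L((x_2,x_3,\dots))=L((x_1,x_2,\dots))$; (3) $L((1,1,\dots))=1$. $\widehat{c}$ is the set of $x\in\ell^\infty$ for which there is $s\in\mathbb R$ with $L(x)=s$ for every Banach limit $L$. $S_0=\{x\in\ell^\infty\colon\lim_n\frac{x_1+\dots+x_n}{n}=0\}$. *)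

(* Defs.v *)
From HB Require Import structures.
From mathcomp Require Import all_boot all_order all_algebra.
From mathcomp Require Import all_classical all_reals all_analysis.
Unset Printing Implicit Defensive.
Import Order.TTheory GRing.Theory Num.Theory.
Import numFieldNormedType.Exports.
Local Open Scope classical_set_scope.
Local Open Scope ring_scope.

Section Defs.
Variable R : realType.

Definition bounded_seq (x : nat -> R) : Prop :=
  exists M : R, forall n, `|x n| <= M.

(* Banach limit: a linear functional on l^infty, positive, shift-invariant,
   normalised.  Values of L outside l^infty are irrelevant. *)
Definition banach_limit (L : (nat -> R) -> R) : Prop :=
  [/\ (forall (a b : R) (x y : nat -> R), bounded_seq x -> bounded_seq y ->
        L (fun n => a * x n + b * y n) = a * L x + b * L y),
      (forall x, bounded_seq x -> (forall n, 0 <= x n) -> 0 <= L x),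
      (forall x, bounded_seq x -> L (fun n => x n.+1) = L x) &
      L (fun _ => 1) = 1].

Definition chat : set (nat -> R) :=
  [set x | bounded_seq x /\
           exists s : R, forall L, banach_limit L -> L x = s].

Definition S0 : set (nat -> R) :=
  [set x | bounded_seq x /\
           (fun n => (\sum_(i < n.+1) x i) / n.+1%:R) @ \oo --> (0 : R)].

Definition half_itv : set R := `](- (2%:R)^-1), (2%:R)^-1[%classic.

Definition Xcube : set (nat -> R) :=
  [set x | forall n, x n \in `](- (2%:R)^-1), (2%:R)^-1[ ].

Definition coord_cyl : set (set (nat -> R)) :=
  [set A | exists (n : nat) (B : set R), measurable B /\ A = (fun x => x n) @^-1` B].

Local Notation seqR := (g_sigma_algebraType coord_cyl).

Definition is_uniform_product (mu : set seqR -> \bar R) : Prop :=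
  forall (n : nat) (B : 'I_n -> set R), (forall i, measurable (B i)) ->
    mu [set x : seqR | forall i : 'I_n, B i (x i)] =
    (\prod_(i < n) lebesgue_measure (B i `&` half_itv))%E.

End Defs.

Notation seqR R := (g_sigma_algebraType (coord_cyl R)).

(* Main.v *)
(* By Chebyshev's inequality along the squares and Borel-Cantelli, the frequency
   of pairwise independent events of equal probability converges almost surely.
   Applied to the events "x_j > c" for c on a grid this gives the strong law for
   the coordinates (a layer-cake approximation), hence (1); applied to the events
   "all terms of the j-th block of length p exceed 1/4" it gives windows of every
   length whose mean is at least 1/4.  By Lorentz' characterization, the means of
   an x in chat over windows of length p are uniformly close to each other for
   large p; as those starting at 0 tend to 0 almost surely, (2) follows.
   The Banach limits needed for Lorentz' theorem are ultralimits of window means;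
   the characterization also gives the measurability of chat on the cube. *)

Require Import Defs.
From HB Require Import structures.
From mathcomp Require Import all_boot all_order all_algebra.
From mathcomp Require Import all_classical all_reals all_analysis.
From mathcomp Require Import measurable_realfun ring lra.
From mathcomp.zify Require Import zify.
Import Order.TTheory GRing.Theory Num.Theory.
Import numFieldNormedType.Exports.
Local Open Scope classical_set_scope.
Local Open Scope ring_scope.

(** * Frequencies of pairwise independent events *)

Lemma exists_natSinv_le (R : archiRealFieldType) (e : R) : 0 < e ->
  exists k : nat, k.+1%:R^-1 <= e.
Proof.
move=> e0; have [k _ /(_ k (leqnn k))/= hk] := near_infty_natSinv_lt (PosNum e0).
by exists k; exact: ltW.
Qed.

Lemma indic_Lfun2 d (T : measurableType d) (R : realType)
    (P : probability T R) (A : set T) :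
  measurable A -> (\1_A : T -> R) \in Lfun P 2%:E.
Proof.
move=> mA; rewrite inE; apply/andP; split; rewrite inE/=.
  exact: measurable_indic.
rewrite /finite_norm unlock/= poweR_lty//.
rewrite (eq_integral (fun x => (\1_A x)%:E)); last first.
  move=> x _ /=; rewrite -[2%R]/(2%:R) powR_mulrn// indicE.
  by case: (x \in A); rewrite /= ?normr1 ?normr0 ?expr1n ?expr0n.
rewrite integral_indic// setIT.
by rewrite (le_lt_trans (probability_le1 P mA))// ltry.
Qed.

(** Pairwise independence makes the covariances of the indicators vanish, so variances add up, and
    each summand has variance [q - q ^ 2 <= 1]. *)
Lemma variance_sum_indic d (T : measurableType d) (R : realType)
    (P : probability T R) (A : nat -> set T) (q : R) :
  (forall i, measurable (A i)) -> (forall i, P (A i) = q%:E) ->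
  (forall i j, i != j -> P (A i `&` A j) = (q * q)%:E) ->
  forall n, let S := fun x => \sum_(i < n) \1_(A i) x in
  [/\ S \in Lfun P 2%:E, ('E_P[S] = (n%:R * q)%:E)%E &
      ('V_P[S] <= n%:R%:E)%E].
Proof.
move=> mA PA PAA n /=.
have Pfin : P setT \is a fin_num := fin_num_measure P _ measurableT.
have q0 : 0 <= q by rewrite -lee_fin -(PA 0%N).
have q1 : q <= 1 by rewrite -lee_fin -(PA 0%N) probability_le1.
have A2 i : (\1_(A i) : T -> R) \in Lfun P 2%:E by exact: indic_Lfun2.
have A1 i := Lfun_subset12 Pfin (A2 i).
have cov i j : i != j -> covariance P (\1_(A i)) (\1_(A j)) = 0%E.
  move=> ij; rewrite covarianceE//; last exact: Lfun2_mul_Lfun1.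
  rewrite -[(_ * _)%R]/(\1_(A i) \* \1_(A j)) -indicI.
  rewrite !expectation_indic ?PAA ?PA//; last exact: measurableI.
  by rewrite -EFinM subee.
(* The later index [k] stays free so that the induction on [m] goes through; only [k = m] is used
   afterwards. *)
have covS m k : (m <= k)%N -> (fun x => \sum_(i < m) \1_(A i) x) \in Lfun P 2%:E /\
    covariance P (fun x => \sum_(i < m) \1_(A i) x) (\1_(A k)) = 0%E.
  elim: m => [_|m IH mk].
    have -> : (fun x : T => \sum_(i < 0) \1_(A i) x) = cst (0 : R).
      by apply/funext => x; rewrite big_ord0.
    by rewrite Lfun_cst covariance_cst_l.
  have -> : (fun x : T => \sum_(i < m.+1) \1_(A i) x) =
            ((fun x => \sum_(i < m) \1_(A i) x) \+ \1_(A m) : T -> R).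
    by apply/funext => x; rewrite big_ord_recr.
  have [h1 h2] := IH (ltnW mk).
  split; first by rewrite rpredD ?lee1n.
  by rewrite covarianceDl// h2 add0e cov// ltn_eqF.
elim: n => [|n [IH1 IH2 IH3]].
  have -> : (fun x : T => \sum_(i < 0) \1_(A i) x) = cst (0 : R).
    by apply/funext => x; rewrite big_ord0.
  by rewrite Lfun_cst expectation_cst variance_cst mul0r.
have -> : (fun x : T => \sum_(i < n.+1) \1_(A i) x) =
          ((fun x => \sum_(i < n) \1_(A i) x) \+ \1_(A n) : T -> R).
  by apply/funext => x; rewrite big_ord_recr.
have [_ c0] := covS n n (leqnn n).
split; first by rewrite rpredD ?lee1n.
- rewrite expectationD//; last exact: Lfun_subset12.
  by rewrite IH2 expectation_indic// PA -EFinD -[in RHS]natr1 mulrDl mul1r.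
- rewrite varianceD// c0 mule0 adde0 -natr1 EFinD leeD//.
  rewrite varianceE// expectation_indic// PA.
  have -> : (\1_(A n) : T -> R) ^+ 2 = \1_(A n).
    by rewrite expr2 -[LHS]/(\1_(A n) \* \1_(A n)) -indicI setIid.
  by rewrite expectation_indic// PA -EFin_expe -EFinB lee_fin; nra.
Qed.

Lemma sum_invr_sqr_le2 (R : realFieldType) n :
  \sum_(k < n) (k.+1%:R ^- 2 : R) <= 2.
Proof.
(* Strengthened so that the induction telescopes: [1 / (t + 1) ^ 2 <= 1 / t - 1 / (t + 1)], with gap
   [1 / (t * (t + 1) ^ 2)]. *)
suff H m : \sum_(k < m.+1) (k.+1%:R ^- 2 : R) <= 2 - m.+1%:R^-1.
  case: n => [|m]; first by rewrite big_ord0.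
  by rewrite (le_trans (H m))// gerBl invr_ge0.
elim: m => [|m IH]; first by rewrite big_ord1 invr1 expr1n invr1; lra.
rewrite big_ord_recr/=; apply: le_trans (lerD IH (lexx _)) _.
rewrite -subr_ge0 -[m.+2%:R]natr1; set t := m.+1%:R : R.
have t0 : 0 < t by rewrite ltr0n.
have -> : 2 - (t + 1)^-1 - (2 - t^-1 + (t + 1) ^- 2) = (t * (t + 1) ^+ 2)^-1.
  by field; rewrite !gt_eqF// ltr_wpDr.
by rewrite invr_ge0 mulr_ge0// ?sqr_ge0// ltW.
Qed.

Lemma nneseries_fin_lty (R : realType) (u : nat -> \bar R) (v : nat -> R) (M : R) :
  (forall n, (0 <= u n)%E) -> (forall n, (u n <= (v n)%:E)%E) ->
  (forall n, \sum_(k < n) v k <= M) -> (\sum_(n <oo) u n < +oo)%E.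
Proof.
move=> u0 uv vM; apply: (@le_lt_trans _ _ M%:E); last exact: ltry.
apply: lime_le; first by apply: is_cvg_nneseries => n _ _; exact: u0.
apply: nearW => n; rewrite big_mkord.
apply: le_trans (_ : ((\sum_(k < n) v k)%:E <= _)%E); last by rewrite lee_fin.
by rewrite -sumEFin; apply: lee_sum => i _.
Qed.

(* An n lies within 2m of the square m ^ 2 below it, and 2m = o(m ^ 2). *)
Lemma bounded_increments_subseq_sqr (R : realType) (D : nat -> R) :
  (forall n, `|D n.+1 - D n| <= 1) ->
  (forall e, 0 < e -> exists M, forall m, (M <= m)%N ->
      `|D (m.+1 ^ 2)%N| <= e * (m.+1 ^ 2)%N%:R) ->
  forall e, 0 < e -> exists N, forall n, (N <= n)%N -> `|D n| <= e * n%:R.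
Proof.
move=> D1 Dsq e e0.
have Dn n k : `|D (n + k)%N| <= `|D n| + k%:R.
  elim: k => [|k IH]; first by rewrite addn0 addr0.
  rewrite addnS -natr1 addrA -(subrK (D (n + k)%N) (D (n + k).+1)) addrC.
  by rewrite (le_trans (ler_normD _ _))// lerD.
have e20 : 0 < e / 2 by rewrite divr_gt0.
have [M HM] := Dsq _ e20.
(* For a root [t >= 4 / e], the at most [2 * t] increments after the square contribute at most
   [(e / 2) * t ^ 2], the same bound as for the square itself. *)
have [K _ HK] : \forall K \near \oo, 4 / e <= K%:R.
  exact: nbhs_infty_ger.
(* Beyond this square the integer root [m] of [n] exceeds both [M] and [K]; in particular it is a
   successor, as the indexing of the squares in [Dsq] requires. *)
exists ((maxn M K).+1 ^ 2)%N => n nN.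
have [m /andP[m1 m2]] : exists m, (m ^ 2 <= n < m.+1 ^ 2)%N.
  elim: n {nN} => [|n [m /andP[m1 m2]]]; first by exists 0%N.
  have [h|h] := ltnP n.+1 (m.+1 ^ 2); first by exists m; rewrite h andbT ltnW.
  by exists m.+1; rewrite h/=; move: m1 m2 h; rewrite !expnS !expn0; nia.
have Mm : (maxn M K < m)%N.
  rewrite ltnNge; apply/negP => h; move: nN; rewrite leqNgt => /negP; apply.
  apply: leq_trans m2 _; rewrite leq_exp2r//.
have -> : n = (m ^ 2 + (n - m ^ 2))%N by rewrite subnKC.
have kb : ((n - m ^ 2)%:R <= 2 * m%:R :> R).
  by rewrite -natrM ler_nat; move: m1 m2; rewrite !expnS !expn0; nia.
case: m Mm m1 m2 kb => // m Mm m1 m2 kb.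
have := HM m; rewrite (leq_trans (leq_maxl M K)) => [/(_ isT) h|]; last by lia.
apply: le_trans (Dn _ _) _; apply: (@le_trans _ _ (e * (m.+1 ^ 2)%:R)).
  apply: le_trans (lerD h kb) _.
  have : 4 / e <= m.+1%:R by apply: HK => /=; move: Mm; lia.
  rewrite ler_pdivrMr// natrX; set t := m.+1%:R : R => ht.
  have t0 : 0 <= t by [].
  nra.
by rewrite ler_pM2l// ler_nat leq_addr.
Qed.

Lemma frequency_cvg d (T : measurableType d) (R : realType)
    (P : probability T R) (A : nat -> set T) (q : R) :
  (forall i, measurable (A i)) -> (forall i, P (A i) = q%:E) ->
  (forall i j, i != j -> P (A i `&` A j) = (q * q)%:E) ->
  {ae P, forall x,
    (fun n => (\sum_(i < n.+1) \1_(A i) x) / n.+1%:R) @ \oo --> q}.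
Proof.
move=> mA PA PAA.
have q0 : 0 <= q by rewrite -lee_fin -(PA 0%N).
have q1 : q <= 1 by rewrite -lee_fin -(PA 0%N) probability_le1.
pose S n x : R := \sum_(i < n) \1_(A i) x.
have VS := variance_sum_indic _ _ _ _ _ _ mA PA PAA.
have mS n : measurable_fun setT (S n).
  by apply: measurable_sum => i; exact: measurable_indic.
(* The event that the frequency at time [(m + 1) ^ 2] misses [q] by at least [1 / (k + 1)].
   Countably many tolerances [k] suffice, so the exceptional null sets can be united. *)
pose F (k m : nat) := [set x | k.+1%:R^-1 * (m.+1 ^ 2)%:R <=
   `|S (m.+1 ^ 2)%N x - (m.+1 ^ 2)%:R * q|].
have mF k m : measurable (F k m).
  rewrite /F; rewrite [X in measurable X](_ : _ =
    (fun x => `|S (m.+1 ^ 2)%N x - (m.+1 ^ 2)%:R * q|) @^-1`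
      `[k.+1%:R^-1 * (m.+1 ^ 2)%:R, +oo[); last first.
    by apply/seteqP; split => x /=; rewrite in_itv/= andbT.
  rewrite -[X in measurable X]setTI.
  apply: (_ : measurable_fun setT _) => //; apply: measurableT_comp => //.
  exact: measurable_funB.
have F0 k : P (lim_sup_set (F k)) = 0%E.
  apply: lim_sup_set_cvg0 => //.
  (* With [N = (m + 1) ^ 2], the variance is at most [N] and the deviation [N / (k + 1)], so
     Chebyshev gives [(k + 1) ^ 2 / N], summable in [m]. *)
  apply: (nneseries_fin_lty _ _ (fun m => k.+1%:R ^+ 2 * m.+1%:R ^- 2)
            (k.+1%:R ^+ 2 * 2)) => //.
  - move=> m.
    have [S2 ES V] := VS (m.+1 ^ 2)%N.
    have Sm : S (m.+1 ^ 2)%N \in @mfun _ _ T R by rewrite inE/=; exact: mS.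
    have e0 : 0 < k.+1%:R^-1 * (m.+1 ^ 2)%:R :> R.
      by rewrite mulr_gt0// ?invr_gt0// ltr0n expn_gt0.
    have := @chebyshev _ _ _ P (mfun_Sub Sm) _ e0.
    rewrite /= ES/= => /le_trans; apply.
    apply: le_trans (lee_wpmul2l _ V) _; first by rewrite lee_fin invr_ge0 sqr_ge0.
    rewrite -EFinM lee_fin natrX le_eqVlt; apply/orP; left; apply/eqP.
    have a0 : k.+1%:R != 0 :> R by rewrite pnatr_eq0.
    have b0 : m.+1%:R != 0 :> R by rewrite pnatr_eq0.
    by move: a0 b0; move: (k.+1%:R) (m.+1%:R) => a b a0 b0; field; rewrite ?a0 ?b0.
  - by move=> n; rewrite -mulr_sumr ler_wpM2l ?sqr_ge0// sum_invr_sqr_le2.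
have : {ae P, forall x, forall k, ~ lim_sup_set (F k) x}.
  apply/ae_foralln => k; exists (lim_sup_set (F k)); split => //.
  - apply: bigcapT_measurable => n; apply: bigcup_measurable => j _; exact: mF.
  - exact: F0.
  - by move=> x /= /contrapT.
apply: filterS => x Fx.
(* Each step changes [S n x - n * q] by [1 - q] or [- q], so control along the squares extends to
   all times. *)
have Dx : forall e, 0 < e -> exists N, forall n, (N <= n)%N ->
    `|S n x - n%:R * q| <= e * n%:R.
  apply: (bounded_increments_subseq_sqr _ (fun n => S n x - n%:R * q)).
    move=> n; rewrite /S big_ord_recr/= -natr1 mulrDl mul1r.
    rewrite (_ : _ - _ = \1_(A n) x - q); last by ring.
    by rewrite indicE ler_norml; case: (_ \in _) => /=; apply/andP; split; lra.
  move=> e e0.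
  have [k ke] := exists_natSinv_le _ _ e0.
  have /existsNP[M /not_implyP[_ FM]] := Fx k.
  exists M => m Mm.
  have : ~ F k m x by move=> Fm; apply: FM; exists m.
  move/negP; rewrite -ltNge => /ltW/le_trans; apply.
  by rewrite ler_wpM2r.
apply/cvgrPdist_le => e e0; have [N HN] := Dx e e0.
exists N => // n /= Nn; have := HN n.+1 (leqW Nn).
rewrite -/(S n.+1 x) distrC => h.
have n0 : 0 < n.+1%:R :> R by rewrite ltr0n.
have -> : q - S n.+1 x / n.+1%:R = (n.+1%:R * q - S n.+1 x) / n.+1%:R.
  by rewrite mulrBl mulrAC divff ?mul1r// gt_eqF.
by rewrite normrM normfV (gtr0_norm n0) ler_pdivrMr.
Qed.

(** * Almost sure events and cylinders of the product measure *)

Lemma ae_of_probability1 d (T : measurableType d) (R : realType)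
    (P : probability T R) (A : set T) :
  measurable A -> P A = 1%E -> {ae P, forall x, A x}.
Proof.
move=> mA PA; exists (~` A); split => //; first exact: measurableC.
by rewrite probability_setC// PA subee.
Qed.

Lemma probability1_of_ae d (T : measurableType d) (R : realType)
    (P : probability T R) (A : set T) :
  measurable A -> {ae P, forall x, A x} -> P A = 1%E.
Proof.
move=> mA [N [mN N0 AN]].
have PAC : P (~` A) = 0%E.
  by apply: subset_measure0 N0 => //; exact: measurableC.
by rewrite -[A]setCK probability_setC ?PAC ?sube0//; exact: measurableC.
Qed.

Lemma measurable_coord (R : realType) (i : nat) :
  measurable_fun setT ((fun x => x i) : seqR R -> R).
Proof.
move=> _ B mB; rewrite setTI; apply: sub_sigma_algebra.
by exists i, B.
Qed.

Lemma measurable_cylinder (R : realType) (B : set R) (s : seq nat) :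
  measurable B ->
  measurable ([set x | {in s, forall i, B (x i)}] : set (seqR R)).
Proof.
move=> mB.
rewrite [X in measurable X](_ : _ = \big[setI/setT]_(i <- s) ((fun x : seqR R => x i) @^-1` B)).
  apply: big_ind => //; first exact: measurableI.
  by move=> i _; rewrite -[X in measurable X]setTI; exact: measurable_coord.
rewrite -bigcap_seq; apply/seteqP; split => x /= h i /=; exact: h.
Qed.

Lemma lebesgue_measure_half_itv (R : realType) :
  lebesgue_measure (half_itv R) = 1%E.
Proof.
rewrite /half_itv lebesgue_measure_itv/= lte_fin ifT; last by lra.
by rewrite -EFinD; congr (_%:E); lra.
Qed.

(** The product formula speaks of initial segments of coordinates only. Take one that contains [s]
    and leave the coordinates outside [s] unconstrained: each of them contributes the factor 1, the
    length of [half_itv]. *)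
Lemma cylinder_probability (R : realType) (mu : probability (seqR R) R)
    (B : set R) (q : R) (s : seq nat) :
  is_uniform_product R mu -> measurable B ->
  lebesgue_measure (B `&` half_itv R) = q%:E -> uniq s ->
  mu [set x | {in s, forall i, B (x i)}] = (q ^+ size s)%:E.
Proof.
move=> hmu mB Bq us.
pose n := (\max_(i <- s) i).+1.
have sn i : i \in s -> (i < n)%N by move=> si; rewrite ltnS; exact: leq_bigmax_seq.
have -> : [set x | {in s, forall i, B (x i)}] =
    [set x : seqR R | forall i : 'I_n, (if val i \in s then B else setT) (x i)].
  apply/seteqP; split => x /= h.
    by move=> i; case: ifPn => // /h.
  by move=> i si; have := h (Ordinal (sn i si)); rewrite /= si.
rewrite (hmu n (fun i => if val i \in s then B else setT)); last first.
  by move=> i; case: ifP.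
rewrite (eq_bigr (fun i : 'I_n => (if val i \in s then q else 1)%:E)); last first.
  by move=> i _; case: ifP => // _; rewrite setTI lebesgue_measure_half_itv.
rewrite -(big_morph EFin (@EFinM R) erefl)/= -big_mkcond/=; congr EFin.
rewrite -(big_mkord (fun i => i \in s) (fun=> q)) -big_filter.
have ps : perm_eq [seq i <- index_iota 0 n | i \in s] s.
  apply: uniq_perm => //; first by rewrite filter_uniq// iota_uniq.
  move=> i; rewrite mem_filter mem_index_iota/=.
  by case si: (i \in s) => //=; exact: sn.
by rewrite (perm_big _ ps)/= big_const_seq count_predT iter_mulr_1.
Qed.

(** Distinct blocks share no index, so two block events intersect in a cylinder over a
    duplicate-free list, of measure [q ^ p * q ^ p]: the events are pairwise independent. *)
Lemma block_frequency (R : realType) (mu : probability (seqR R) R)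
    (B : set R) (q : R) (p : nat) :
  is_uniform_product R mu -> measurable B ->
  lebesgue_measure (B `&` half_itv R) = q%:E ->
  {ae mu, forall x : seqR R,
    (fun n => (\sum_(j < n.+1)
       \1_[set x : seqR R | {in iota (j * p) p, forall i, B (x i)}] x)
       / n.+1%:R) @ \oo --> q ^+ p}.
Proof.
move=> hmu mB Bq.
have h s us : mu [set x | {in s, forall i, B (x i)}] = _ :=
  cylinder_probability _ _ _ _ s hmu mB Bq us.
apply: (frequency_cvg _ _ _ _
  (fun j => [set x : seqR R | {in iota (j * p) p, forall i, B (x i)}])).
- by move=> j; exact: measurable_cylinder.
- by move=> j; rewrite h ?iota_uniq// size_iota.
- move=> j k jk.
  rewrite [X in mu X](_ : _ = [set x | {in iota (j * p) p ++ iota (k * p) p,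
      forall i, B (x i)}]).
    rewrite h; first by rewrite size_cat !size_iota exprD.
    rewrite cat_uniq !iota_uniq andbT/=.
    apply/hasPn => i; rewrite !mem_iota => /andP[h1 h2]; apply/negP => /andP[h3 h4].
    by move/eqP: jk; apply; nia.
  apply/seteqP; split => x /=.
    by move=> [h1 h2] i; rewrite mem_cat => /orP[/h1|/h2].
  by move=> hx; split => i hi; apply: hx; rewrite mem_cat hi ?orbT.
Qed.

(** * Layer-cake approximation and the strong law for the coordinates *)

Lemma sum_succ_lt (R : realFieldType) (u : R) n : 0 < u ->
  (n%:R < u -> \sum_(k < n) (k.+1%:R < u)%R%:R = n%:R :> R) /\
  (u <= n%:R -> u - 1 <= \sum_(k < n) (k.+1%:R < u)%R%:R <= u).
Proof.
move=> u0; elim: n => [|n [IH1 IH2]].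
  by rewrite big_ord0; split => // /le_lt_trans/(_ u0); rewrite ltxx.
rewrite big_ord_recr/= -!natr1; split => [nu|un].
  by rewrite nu IH1//; apply: lt_trans nu; rewrite ltrDl.
(* The new term is 0. Either [u] was passed before, or [n < u <= n + 1] and by the first clause the
   count is exactly [n]. *)
rewrite ltNge un/= addr0; have [/IH2//|nu] := leP u n%:R.
by rewrite IH1//; apply/andP; split; lra.
Qed.

(** The expected number of tails that contain a uniform coordinate. For [n = K] the value is
    [(K - 1) / 2]. *)
Lemma sum_uniform_tails (R : realFieldType) n (K : R) : K != 0 ->
  \sum_(k < n) (1 - k.+1%:R / K) = n%:R - n%:R * (n%:R + 1) / (2 * K).
Proof.
move=> K0; elim: n => [|n IH]; first by rewrite big_ord0 !mul0r subrr.
rewrite big_ord_recr/= IH -!natr1; move: (n%:R) => t; field.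
by rewrite K0.
Qed.

(* For t in (-1/2, 1/2), the k <= K with t in tail R K k are those with
   k + 1 < (K + 1)(t + 1/2), so their number approximates (K + 1)(t + 1/2). *)
Definition tail (R : realType) (K k : nat) : set R :=
  `]k.+1%:R / K.+1%:R - 2^-1, +oo[%classic.

Lemma sum_tailP (R : realType) (K : nat) (t : R) : half_itv R t ->
  K.+1%:R * (t + 2^-1) - 1 <= \sum_(k < K.+1) \1_(tail R K k) t
    <= K.+1%:R * (t + 2^-1).
Proof.
rewrite /half_itv/= in_itv/= => /andP[t1 t2].
have K0 : 0 < K.+1%:R :> R by rewrite ltr0n.
have tailE k : \1_(tail R K k) t = (k.+1%:R < K.+1%:R * (t + 2^-1))%R%:R :> R.
  rewrite indicE /tail mem_setE in_itv/= andbT ltrBlDr ltr_pdivrMr//.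
  by rewrite [_ * K.+1%:R]mulrC.
rewrite (eq_bigr _ (fun k _ => tailE (val k))).
have u0 : 0 < K.+1%:R * (t + 2^-1) by rewrite mulr_gt0//; lra.
have [_ ->//] := sum_succ_lt _ _ K.+1 u0.
by rewrite ler_piMr//; lra.
Qed.

Lemma lebesgue_measure_tail (R : realType) (K k : nat) : (k <= K)%N ->
  lebesgue_measure (tail R K k `&` half_itv R) = (1 - k.+1%:R / K.+1%:R)%:E.
Proof.
move=> kK; set c := k.+1%:R / K.+1%:R : R.
have K0 : 0 < K.+1%:R :> R by rewrite ltr0n.
have c0 : 0 <= c by rewrite divr_ge0.
have c1 : c <= 1 by rewrite /c ler_pdivrMr// mul1r ler_nat ltnS.
rewrite (_ : _ `&` _ = `]c - 2^-1, 2^-1[%classic); last first.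
  rewrite /tail /half_itv -/c; apply/seteqP; split => t /=; rewrite !in_itv/= andbT.
    by move=> [-> /andP[_ ->]].
  by move=> /andP[t1 ->]; split=> //; rewrite andbT; lra.
(* The second case is [k = K]: the interval is empty and [c = 1]. *)
rewrite lebesgue_measure_itv/= lte_fin; case: ltP => [_|h].
  by rewrite -EFinD; congr (_%:E); lra.
by congr (_%:E); lra.
Qed.

(** Averaging [sum_tailP] over the terms of [x] compares the mean with a finite sum of tail
    frequencies, whose limit is known; after division by [K + 1] the error is of order
    [1 / (K + 1)]. *)
Lemma mean_cvg0_of_tail_frequency (R : realType) (x : nat -> R) :
  (forall n, half_itv R (x n)) ->
  (forall K k, (k <= K)%N ->
     (fun n => (\sum_(j < n.+1) \1_(tail R K k) (x j)) / n.+1%:R) @ \oo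
       --> (1 - k.+1%:R / K.+1%:R : R)) ->
  (fun n => (\sum_(i < n.+1) x i) / n.+1%:R) @ \oo --> (0 : R).
Proof.
move=> xX xf; apply/cvgrPdist_le => e e0.
have [K Ke] := exists_natSinv_le _ _ e0.
have K0 : 0 < K.+1%:R :> R by rewrite ltr0n.
have G : (fun n => \sum_(k < K.+1) ((\sum_(j < n.+1) \1_(tail R K k) (x j)) / n.+1%:R))
    @ \oo --> \sum_(k < K.+1) (1 - k.+1%:R / K.+1%:R : R).
  apply: cvg_big => [|k _]; first exact: add_continuous.
  by apply: xf; rewrite -ltnS.
rewrite sum_uniform_tails ?gt_eqF// in G.
(* Tolerance 1/2 is enough: [g] is then within 1/2 of [(K + 1) / 2 - 1 / 2], and the sandwich for
   [g] below gives [(K + 1) * |a| <= 1]. *)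
have h0 : 0 < 2^-1 :> R by rewrite invr_gt0.
move/cvgrPdist_le : G => /(_ _ h0); apply: filterS => n.
rewrite sub0r normrN; set a := _ / n.+1%:R; set g := \sum_(k < _) _ => Gn.
have n0 : 0 < n.+1%:R :> R by rewrite ltr0n.
have gE : g = (\sum_(j < n.+1) \sum_(k < K.+1) \1_(tail R K k) (x j)) / n.+1%:R.
  by rewrite /g -mulr_suml exchange_big.
have /andP[g1 g2] : K.+1%:R * (a + 2^-1) - 1 <= g <= K.+1%:R * (a + 2^-1).
  have lin (c : R) : \sum_(j < n.+1) (K.+1%:R * (x j + 2^-1) - c) =
      (K.+1%:R * (a + 2^-1) - c) * n.+1%:R.
    rewrite sumrB -mulr_sumr big_split/= !sumr_const card_ord.
    rewrite -[2^-1 *+ _]mulr_natr -[c *+ _]mulr_natr.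
    have := gt_eqF n0; rewrite /a.
    move: (n.+1%:R) (\sum_(i < n.+1) x i) (K.+1%:R) => N s t N0.
    by field; rewrite N0.
  rewrite gE ler_pdivlMr// ler_pdivrMr// -lin.
  have := lin 0; rewrite !subr0 => <-.
  apply/andP; split; apply: ler_sum => j _; have /andP[s1 s2] := sum_tailP _ K _ (xX j) => //.
  by rewrite subr0.
rewrite -(ler_pM2l K0); apply: (@le_trans _ _ 1); last first.
  by rewrite -ler_pdivrMl// mulr1.
rewrite -{1}(gtr0_norm K0) -normrM.
move: Gn g1 g2.
rewrite (_ : _ - _ / (2 * _) = K.+1%:R / 2 - 2^-1); last first.
  by move: (K.+1%:R) K0 => t t0; field; rewrite gt_eqF.
rewrite !ler_norml => /andP[s1 s2] g1 g2; apply/andP; split; lra.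
Qed.

Lemma coord_half_ae (R : realType) (mu : probability (seqR R) R) :
  is_uniform_product R mu -> {ae mu, forall x : seqR R, Xcube R x}.
Proof.
move=> hmu.
have : {ae mu, forall x : seqR R, forall n, {in [:: n], forall i, half_itv R (x i)}}.
  apply/ae_foralln => n.
  have mh : measurable (half_itv R) by exact: measurable_itv.
  apply: (ae_of_probability1 _ _ _ mu [set x | {in [:: n], forall i, half_itv R (x i)}]).
    exact: measurable_cylinder.
  rewrite (cylinder_probability _ _ _ 1) ?expr1//.
  by rewrite setIid lebesgue_measure_half_itv.
by apply: filterS => x hx n; apply: (hx n); rewrite inE.
Qed.

Lemma Xcube_bounded (R : realType) (x : nat -> R) : Xcube R x -> bounded_seq R x.
Proof.
move=> xX; exists 1 => n; have := xX n; rewrite in_itv/= ler_norml => /andP[h1 h2].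
by apply/andP; split; lra.
Qed.

Lemma S0_Xcube_ae (R : realType) (mu : probability (seqR R) R) :
  is_uniform_product R mu -> {ae mu, forall x : seqR R, (S0 R `&` Xcube R) x}.
Proof.
move=> hmu.
have H : {ae mu, forall x : seqR R, forall K k, (k <= K)%N ->
    (fun n => (\sum_(j < n.+1) \1_(tail R K k) (x j)) / n.+1%:R) @ \oo
       --> (1 - k.+1%:R / K.+1%:R : R)}.
  apply/ae_foralln => K; apply/ae_foralln => k.
  have [kK|kK] := leqP k K; last by apply: aeW.
  have mt : measurable (tail R K k) by exact: measurable_itv.
  (* Blocks of length 1 are the single coordinates. *)
  have := block_frequency _ _ _ _ 1 hmu mt (lebesgue_measure_tail R K k kK).
  apply: filterS => x; rewrite expr1 => + _.
  apply: cvg_trans; apply: near_eq_cvg; apply: nearW => n; congr (_ / _).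
  apply: eq_bigr => j _; rewrite !indicE; congr (_%:R); congr nat_of_bool.
  apply/idP/idP; rewrite !inE/=.
    by apply; rewrite muln1 mem_head.
  by move=> h i; rewrite mem_seq1 muln1 => /eqP ->.
move: (coord_half_ae _ _ hmu) H; apply: (@filterS2 (seqR R)) => x xX xf.
split => //; split; first exact: Xcube_bounded.
exact: mean_cvg0_of_tail_frequency.
Qed.

(** * Banach limits from window means, and Lorentz' characterization *)

Lemma bounded_cvg_ultra (R : realType) (T : Type) (U : set_system T)
    (u : T -> R) (M : R) :
  UltraFilter U -> (forall k, `|u k| <= M) -> cvg (u @ U).
Proof.
move=> UU uM.
have cM : compact (`[- M, M] : set R) by exact: segment_compact.
have UM : U (u @^-1` `[- M, M]).
  by apply: filterE => k; rewrite /= in_itv/= -ler_norml.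
(* A cluster point of an ultrafilter is a limit: were the preimage of a neighbourhood [V] not in
   [U], its complement would be, and [V] would have to meet its own complement. *)
have [p [_ clp]] := cM (u @ U) _ UM; apply/cvg_ex; exists p => V Vp.
have [//|UV] := in_ultra_setVsetC (u @^-1` V) UU.
by have [z []] := clp (~` V) V UV Vp.
Qed.

Section Means.
Context {R : realType}.
Implicit Types (x y : nat -> R) (L : (nat -> R) -> R).

(** The window has [p.+1] terms, so the denominator never vanishes. *)
Definition mean x (n p : nat) : R := (\sum_(i < p.+1) x (n + i)%N) / p.+1%:R.

Lemma norm_mean_le x (M : R) n p : (forall i, `|x i| <= M) -> `|mean x n p| <= M.
Proof.
move=> xM; have p0 : 0 < p.+1%:R :> R by rewrite ltr0n.
rewrite /mean normrM normfV (gtr0_norm p0) ler_pdivrMr//.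
apply: le_trans (ler_norm_sum _ _ _) _.
apply: (@le_trans _ _ (\sum_(i < p.+1) M)); first exact: ler_sum.
by rewrite sumr_const card_ord mulr_natr.
Qed.

Lemma meanD (a b : R) x y n p :
  mean (fun k => a * x k + b * y k) n p = a * mean x n p + b * mean y n p.
Proof. by rewrite /mean big_split/= -!mulr_sumr mulrDl !mulrA. Qed.

Lemma mean_cst (c : R) n p : mean (fun=> c) n p = c.
Proof.
by rewrite /mean sumr_const card_ord -[c *+ _]mulr_natr mulfK// pnatr_eq0.
Qed.

(** The two windows overlap except for one term at each end. *)
Lemma mean_shift_dist x (M : R) n p : (forall i, `|x i| <= M) ->
  `|mean (fun k => x k.+1) n p - mean x n p| <= M * 2 / p.+1%:R.
Proof.
move=> xM; have p0 : 0 < p.+1%:R :> R by rewrite ltr0n.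
rewrite /mean -mulrBl normrM normfV (gtr0_norm p0) ler_pM2r ?invr_gt0//.
rewrite big_ord_recr/= [in X in _ - X]big_ord_recl/= addn0.
under [in X in _ - X]eq_bigr do rewrite /bump/= add1n addnS.
rewrite [X in `|X|](_ : _ = x (n + p).+1 - x n); last by ring.
by rewrite mulr_natr mulr2n (le_trans (ler_normB _ _))// lerD.
Qed.

(** Total because [lim] has a default value; on bounded sequences and for an ultrafilter [U] it is a
    genuine limit. *)
Definition window_limit (U : set_system nat) (n p : nat -> nat) :
    (nat -> R) -> R :=
  fun x => lim ((fun k => mean x (n k) (p k)) @ U).

Lemma window_limit_cvg (U : set_system nat) (n p : nat -> nat) x :
  UltraFilter U -> bounded_seq R x ->
  (fun k => mean x (n k) (p k)) @ U --> window_limit U n p x.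
Proof.
move=> UU [M xM]; apply: (@bounded_cvg_ultra _ _ _ _ M) => k.
exact: norm_mean_le.
Qed.

(** Shift invariance is the point: the shift moves the [k]-th mean by at most [2 * M / (k + 1)],
    which vanishes along [U] since [U] refines [\oo]. The starting points [n k] are arbitrary. *)
Lemma window_limit_banach (U : set_system nat) (n p : nat -> nat) :
  UltraFilter U -> \oo `<=` U -> (forall k, (k <= p k)%N) ->
  banach_limit R (window_limit U n p).
Proof.
move=> UU ooU kp; split.
- move=> a b x y bx byy; apply/cvg_lim => //.
  under eq_fun do rewrite meanD.
  by apply: cvgD; apply: cvgMr; exact: window_limit_cvg.
- move=> x bx x0; apply: limr_ge.
    by apply/cvg_ex; exists (window_limit U n p x); exact: window_limit_cvg.
  by apply: filterE => k; rewrite /mean divr_ge0// sumr_ge0.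
- move=> x [M xM].
  have bx : bounded_seq R x by exists M.
  have bx' : bounded_seq R (fun n => x n.+1) by exists M.
  have inv0 : (fun k => M * 2 / k.+1%:R) @ U --> (0 : R).
    apply: cvg_trans (_ : (fun k => M * 2 / k.+1%:R) @ \oo --> (0 : R)).
      by move=> V /ooU.
    by rewrite -[X in _ --> X](mulr0 (M * 2)); apply: cvgMr; exact: cvg_harmonic.
  have d0 : (fun k => mean (fun i => x i.+1) (n k) (p k) - mean x (n k) (p k))
      @ U --> (0 : R).
    apply: (@squeeze_cvgr _ _ _ _ (fun k => - (M * 2 / k.+1%:R))
      (fun k => M * 2 / k.+1%:R)).
    - apply: filterE => k; rewrite -ler_norml.
      apply: le_trans (mean_shift_dist _ _ _ _ xM) _.
      have M0 : 0 <= M by apply: le_trans (xM 0%N).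
      by rewrite ler_wpM2l ?mulr_ge0// lef_pV2 ?posrE// ler_nat ltnS.
    - by rewrite -oppr0; apply: cvgN; exact: inv0.
    - exact: inv0.
  have dL : (fun k => mean (fun i => x i.+1) (n k) (p k) - mean x (n k) (p k))
      @ U --> window_limit U n p (fun i => x i.+1) - window_limit U n p x.
    by apply: cvgB; exact: window_limit_cvg.
  by apply/eqP; rewrite -subr_eq0; apply/eqP; exact: cvg_unique dL d0.
- rewrite /window_limit; under eq_fun do rewrite mean_cst.
  exact: lim_cst.
Qed.

Lemma banach_limit_bounds L y (a b : R) : banach_limit R L ->
  (forall n, a <= y n <= b) -> a <= L y <= b.
Proof.
move=> [lin pos _ one] yab.
have by_ : bounded_seq R y.
  exists (`|a| + `|b|) => n; have /andP[ya yb] := yab n.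
  have := ler_norm b; have := ler_norm (- a); rewrite normrN => ha hb.
  have := normr_ge0 a; have := normr_ge0 b => b0 a0.
  by rewrite ler_norml; apply/andP; split; lra.
have b1 : bounded_seq R (fun=> 1) by exists 1 => n; rewrite normr1.
have comb (c d : R) : (forall n, 0 <= c * y n + d * 1) -> 0 <= c * L y + d.
  move=> h; rewrite -[d in leRHS]mulr1 -[X in d * X]one -lin//; apply: pos => //.
  have [M yM] := by_; exists (`|c| * M + `|d|) => n.
  by rewrite mulr1 (le_trans (ler_normD _ _))// lerD// normrM ler_wpM2l.
apply/andP; split.
  have := comb 1 (- a); rewrite mul1r subr_ge0; apply=> n.
  by rewrite mul1r mulr1 subr_ge0; case/andP: (yab n).
have := comb (- 1) b; rewrite mulN1r addrC subr_ge0; apply=> n.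
by rewrite mulN1r mulr1 addrC subr_ge0; case/andP: (yab n).
Qed.

(** The sequence of window means is the average of [p.+1] shifts of [x], on each of which [L] takes
    the value [L x]. *)
Lemma banach_limit_mean L x p : banach_limit R L -> bounded_seq R x ->
  L (fun n => mean x n p) = L x.
Proof.
move=> [lin pos sh one] bx.
have bsh i : bounded_seq R (fun n => x (n + i)%N).
  by have [M xM] := bx; exists M.
have Lsh i : L (fun n => x (n + i)%N) = L x.
  elim: i => [|i IH]; first by under eq_fun do rewrite addn0.
  rewrite -IH -(sh _ (bsh i)); congr L; apply/funext => n.
  by rewrite addnS addSn.
have bS q : bounded_seq R (fun n => \sum_(i < q) x (n + i)%N).
  have [M xM] := bx; exists (\sum_(i < q) M) => n.
  by rewrite (le_trans (ler_norm_sum _ _ _))// ler_sum.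
have b0 : bounded_seq R (fun=> 0) by exists 0 => n; rewrite normr0.
have LS q : L (fun n => \sum_(i < q) x (n + i)%N) = q%:R * L x.
  elim: q => [|q IH].
    rewrite mul0r; under eq_fun do rewrite big_ord0.
    by have := lin 0 0 _ _ b0 b0; rewrite !mul0r !addr0.
  rewrite -natr1 mulrDl mul1r -IH -[in RHS](Lsh q).
  rewrite -[X in X + _]mul1r -[X in _ + X]mul1r -lin//.
  by congr L; apply/funext => n; rewrite big_ord_recr/= !mul1r.
have := lin p.+1%:R^-1 0 _ _ (bS p.+1) b0.
rewrite LS [0 * L _]mul0r addr0 mulKf ?pnatr_eq0// => <-.
by congr L; apply/funext => n; rewrite mul0r addr0 mulrC.
Qed.

(** Lorentz' condition with the window at 0 in place of the limit value and with tolerances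
    [1 / (k + 1)], so that it is visibly built from countably many conditions on means. *)
Definition uniform_means x := forall k, exists P, forall p n, (P <= p)%N ->
  `|mean x n p - mean x 0 p| <= k.+1%:R^-1.

(** A Banach limit does not distinguish [x] from its window means of a fixed length, and for a long
    window these all lie within [e / 2] of one number [c]. *)
Lemma uniform_means_banach x L1 L2 : bounded_seq R x -> uniform_means x ->
  banach_limit R L1 -> banach_limit R L2 -> L1 x = L2 x.
Proof.
move=> bx ux B1 B2; apply/eqP; rewrite -subr_eq0 -normr_le0; apply/ler_addgt0Pr => e e0.
have e20 : 0 < e / 2 by rewrite divr_gt0.
have [k ke] := exists_natSinv_le _ _ e20.
have [P HP] := ux k; set c := mean x 0 P.
have near_c L : banach_limit R L -> c - e / 2 <= L x <= c + e / 2.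
  move=> B; rewrite -(banach_limit_mean _ _ P B bx).
  apply: banach_limit_bounds => // n.
  by have := le_trans (HP P n (leqnn P)) ke; rewrite ler_distl.
have /andP[h1 h2] := near_c _ B1; have /andP[h3 h4] := near_c _ B2.
by rewrite add0r ler_norml; apply/andP; split; lra.
Qed.

(** Otherwise there are arbitrarily long windows whose mean stays a fixed distance from that of the
    window of equal length at 0. The ultralimits along these two families of windows are Banach
    limits that differ at [x]. *)
Lemma banach_uniform_means x : bounded_seq R x ->
  (forall L1 L2, banach_limit R L1 -> banach_limit R L2 -> L1 x = L2 x) ->
  uniform_means x.
Proof.
move=> bx LL; apply: contrapT => /existsNP[k nP].
have {}nP P : exists pn : nat * nat, (P <= pn.1)%N /\
    k.+1%:R^-1 < `|mean x pn.2 pn.1 - mean x 0 pn.1|.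
  move/forallNP/(_ P) : nP => /existsNP[p /existsNP[n /not_implyP[Pp /negP]]].
  by rewrite -ltNge => h; exists (p, n).
have [f Hf] := choice nP.
have [U [UU ooU]] := @ultraFilterLemma nat \oo _.
have B n : banach_limit R (window_limit U n (fun P => (f P).1)).
  by apply: window_limit_banach => // P; case: (Hf P).
have := LL _ _ (B (fun P => (f P).2)) (B (fun=> 0%N)).
set p := fun P => (f P).1; set n := fun P => (f P).2 => Leq.
have : (fun P => `|mean x (n P) (p P) - mean x 0 (p P)|) @ U --> (0 : R).
  rewrite -[X in _ --> X](@normr0 _ R); apply: cvg_norm.
  rewrite -(subrr (window_limit U n p x)) [X in _ - X]Leq.
  by apply: cvgB; exact: window_limit_cvg.
have k0 : 0 < k.+1%:R^-1 :> R by rewrite invr_gt0.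
move=> d0; have [P] := filter_ex (cvgr_lt (0 : R) d0 _ k0).
by have [_ /ltW] := Hf P; rewrite leNgt => /negP.
Qed.

(* Lorentz' characterization of almost convergence *)
Lemma chatP x : bounded_seq R x -> chat R x <-> uniform_means x.
Proof.
move=> bx; split => [[_ [s Ls]]|ux].
  by apply: banach_uniform_means => // L1 L2 B1 B2; rewrite !Ls.
(* The common value is read off from any Banach limit; were there none, every value would do, and 0
   is taken. *)
split=> //; have [[L0 B0]|noL] := pselect (exists L, banach_limit R L).
  by exists (L0 x) => L B; exact: uniform_means_banach.
by exists 0 => L B; case: noL; exists L.
Qed.

End Means.

(** * Measurability on the cube *)

Lemma measurable_mean (R : realType) (n p : nat) :
  measurable_fun setT ((fun x => mean x n p) : seqR R -> R).
Proof.
apply: measurable_funM => //; apply: measurable_sum => i.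
exact: measurable_coord.
Qed.

Lemma measurable_norm_le (R : realType) (f : seqR R -> R) (e : R) :
  measurable_fun setT f -> measurable [set x | `|f x| <= e].
Proof.
move=> mf; rewrite (_ : [set x | _] = setT `&` (fun x => `|f x|) @^-1` `]-oo, e]).
  by apply: (measurableT_comp _ mf) => //; exact: measurable_itv.
by rewrite setTI; apply/seteqP; split => x /=; rewrite in_itv.
Qed.

Lemma measurable_Xcube (R : realType) : measurable (Xcube R : set (seqR R)).
Proof.
rewrite (_ : Xcube R = \bigcap_n ((fun x : seqR R => x n) @^-1` half_itv R)).
  apply: bigcapT_measurable => n; rewrite -[X in measurable X]setTI.
  by apply: measurable_coord => //; exact: measurable_itv.
by apply/seteqP; split => x h n => [_|]; exact: h.
Qed.

Lemma measurable_S0_Xcube (R : realType) :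
  measurable (S0 R `&` Xcube R : set (seqR R)).
Proof.
rewrite (_ : _ `&` _ = Xcube R `&` \bigcap_k \bigcup_N \bigcap_(p in [set p | (N <= p)%N])
    [set x : seqR R | `|mean x 0 p| <= k.+1%:R^-1]).
  apply: measurableI; first exact: measurable_Xcube.
  apply: bigcapT_measurable => k; apply: bigcupT_measurable => N.
  apply: bigcap_measurable => [|p _]; first by exists N => /=.
  exact: measurable_norm_le (measurable_mean _ _ _).
apply/seteqP; split => x [].
  move=> [_ /cvgrPdist_le x0] xX; split => // k _.
  have k0 : 0 < k.+1%:R^-1 :> R by rewrite invr_gt0.
  have [N _ HN] := x0 _ k0; exists N => // p /= Np.
  by have := HN p Np; rewrite /= sub0r normrN.
move=> xX xk; split => //; split; first exact: Xcube_bounded.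
apply/cvgrPdist_le => e e0.
have [k ke] := exists_natSinv_le _ _ e0.
have [N _ HN] := xk k I; exists N => // p Np.
by rewrite /= sub0r normrN; apply: le_trans ke; exact: HN.
Qed.

Lemma measurable_chat_Xcube (R : realType) :
  measurable (chat R `&` Xcube R : set (seqR R)).
Proof.
rewrite (_ : _ `&` _ = Xcube R `&` \bigcap_k \bigcup_P \bigcap_(p in [set p | (P <= p)%N])
    \bigcap_n [set x : seqR R | `|mean x n p - mean x 0 p| <= k.+1%:R^-1]).
  apply: measurableI; first exact: measurable_Xcube.
  apply: bigcapT_measurable => k; apply: bigcupT_measurable => P.
  apply: bigcap_measurable => [|p _]; first by exists P => /=.
  apply: bigcapT_measurable => n; apply: measurable_norm_le.
  by apply: measurable_funB; exact: measurable_mean.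
apply/seteqP; split => x [].
  move=> + xX; move/(chatP _ (Xcube_bounded _ _ xX)) => ux; split => // k _.
  by have [P HP] := ux k; exists P => // p Pp n _; exact: HP.
move=> xX h; split => //; apply/(chatP _ (Xcube_bounded _ _ xX)) => k.
by have [P _ HP] := h k I; exists P => p n Pp; exact: HP.
Qed.

(** * Windows of large mean, and the conclusion *)

Lemma large_window_ae (R : realType) (mu : probability (seqR R) R) :
  is_uniform_product R mu -> {ae mu, forall x : seqR R, forall p,
    exists n, 4^-1 <= mean x n p}.
Proof.
move=> hmu; apply/ae_foralln => p.
have mB : measurable (`]4^-1, +oo[%classic : set R) by exact: measurable_itv.
have Bq : lebesgue_measure ((`]4^-1, +oo[%classic : set R) `&` half_itv R) = (4^-1)%:E.
  rewrite (_ : _ `&` _ = `]4^-1, 2^-1[%classic); last first.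
    rewrite /half_itv; apply/seteqP; split => t /=; rewrite !in_itv/= andbT.
      by move=> [-> /andP[_ ->]].
    by move=> /andP[t1 ->]; split=> //; rewrite andbT; lra.
  rewrite lebesgue_measure_itv/= lte_fin ifT; last by lra.
  by rewrite -EFinD; congr (_%:E); lra.
have := block_frequency _ _ _ _ p.+1 hmu mB Bq.
apply: (@filterS (seqR R)) => x xf.
apply: contrapT => /forallNP nx.
(* A block with all terms above 1/4 would be a window of mean at least 1/4. If there is none, the
   block frequencies are identically 0, yet they converge to a positive power of 1/4. *)
have : (0 : R) = 4^-1 ^+ p.+1.
  apply: cvg_unique xf => //.
  rewrite [X in X @ _](_ : _ = cst 0); first exact: cvg_cst.
  apply/funext => n; rewrite big1 ?mul0r// => j _.
  rewrite indicE memNset// => xj; apply: (nx (j * p.+1)%N).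
  rewrite /mean ler_pdivlMr ?ltr0n//.
  rewrite (_ : 4^-1 * _ = \sum_(i < p.+1) 4^-1); last first.
    by rewrite sumr_const card_ord mulr_natr.
  apply: ler_sum => i _; have := xj (j * p.+1 + i)%N.
  rewrite mem_iota leq_addr ltn_add2l ltn_ord => /(_ isT).
  by rewrite /= in_itv/= andbT => /ltW.
by move/eqP; rewrite lt_eqF// exprn_gt0// invr_gt0.
Qed.

Theorem theorem4p1 (R : realType) (mu : probability (seqR R) R)
  (hmu : is_uniform_product R mu) :
  (measurable (S0 R `&` Xcube R : set (seqR R)) /\
   mu (S0 R `&` Xcube R) = 1%E) /\
  (measurable (chat R `&` Xcube R : set (seqR R)) /\
   mu (chat R `&` Xcube R) = 0%E).
Proof.
have mS := measurable_S0_Xcube R; have mc := measurable_chat_Xcube R.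
split; split => //.
  by apply: probability1_of_ae => //; exact: S0_Xcube_ae.
suff ae_not : {ae mu, forall x : seqR R, (~` (chat R `&` Xcube R)) x}.
  have := probability1_of_ae _ _ _ _ _ (measurableC mc) ae_not.
  by move=> h; rewrite -[_ `&` _]setCK probability_setC ?h ?subee//; exact: measurableC.
move: (S0_Xcube_ae _ _ hmu) (large_window_ae _ _ hmu).
apply: (@filterS2 (seqR R)) => x [[_ x0] xX] xn [cx _].
(* Index 15 means tolerance 1/16. Together with a mean at 0 of at most 1/16, every window of length
   [p.+1] has mean at most 1/8, less than 1/4. *)
have [P HP] := (chatP _ (Xcube_bounded _ _ xX)).1 cx 15%N.
have h0 : 0 < 16^-1 :> R by rewrite invr_gt0.
have [N _ HN] := (cvgrPdist_le _ _).1 x0 _ h0.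
set p := maxn P N.
have [n xnp] := xn p.
have := HP p n (leq_maxl _ _); have := HN p (leq_maxr _ _).
rewrite /= sub0r normrN.
rewrite (_ : _ / _ = mean x 0 p)//.
rewrite ler_norml ler_distl => /andP[_ a1] /andP[_ a2].
by lra.
Qed.
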